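(* Let $n\ge 2$. For the class $\mathcal{G}$ of metric sequential transportation games with $n$ players and $n$ buses, $\mathrm{SPoA}(E,\mathcal{G})=2n-1$.
   Context: Transportation game. An instance $\Gamma$ consists of a set of players $N=\{1,\dots,n\}$ ($n\ge 1$), a set of buses $M=\{1,\dots,m\}$ with $m\ge 2$, a complete undirected graph on the vertex set $V=N\cup\{s,t\}$ ($s$ the source, $t$ the destination) with a distance function $d$ assigning a nonnegative real $d(x,y)=d(y,x)$ to each edge (with $d(x,x)=0$), and for each bus $j\in M$ a permutation $\pi_j$ of $N$. The instance is metric if $d(x,w)\le d(x,y)+d(y,w)$ for all $x,y,w\in V$. Distances between distinct vertices may be $0$. An outcome is a map $\sigma:N\to M$, $\sigma_i$ being the bus chosen by player $i$; $\mathcal{P}$ is the set of outcomes. Given $\sigma$, bus $j$ starts at $s$, visits exactly the players $i$ with $\sigma_i=j$, in the order in which they appear in $\pi_j$, and ends at $t$. Let $n_j=|\{i:\sigma_i=j\}|$, let $p^j_i$ be the $i$-th player visited by bus $j$, and put $p^j_{n_j+1}=t$. The cost of the player $p^j_k$ is $c_{p^j_k}(\sigma)=\sum_{l=k}^{n_j} d(p^j_l,p^j_{l+1})$, the distance travelled by her bus from her location to $t$. The egalitarian social cost function is $E(\sigma)=\max_{i\in N}c_i(\sigma)$. Sequential version. Players choose buses in the order $1,2,\dots,n$, each observing all earlier choices. A strategy of player $i$ is a function $\lambda_i$ assigning a bus to each possible history $\sigma_{<i}=(\sigma_1,\dots,\sigma_{i-1})\in M^{i-1}$; a strategy profile is $\lambda=(\lambda_1,\dots,\lambda_n)$.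 Its outcome is the $\sigma$ with $\sigma_i=\lambda_i(\sigma_{<i})$ for all $i$. A strategy profile $\lambda$ is a subgame perfect equilibrium (SPE) if for every player $i$ and every history $\sigma_{<i}$, player $i$ cannot decrease her cost by choosing a bus other than $\lambda_i(\sigma_{<i})$ after the history $\sigma_{<i}$, when players $i+1,\dots,n$ then play according to $\lambda_{i+1},\dots,\lambda_n$. An SPE always exists. For a social cost function $f$, $f(\lambda)$ denotes $f$ of the outcome of $\lambda$. With $\sigma^*\in\mathcal{P}$ minimizing $f$, $\mathrm{SPoA}(f,\Gamma)=\max_{\lambda\in \mathrm{SPE}(\Gamma)} f(\lambda)/f(\sigma^* )$, and for a class $\mathcal{G}$ of games $\mathrm{SPoA}(f,\mathcal{G})=\sup_{\Gamma\in\mathcal{G}}\mathrm{SPoA}(f,\Gamma)$, the supremum being over the $\Gamma\in\mathcal{G}$ with $f(\sigma^* )>0$. *)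

(* Defs.v *)
From HB Require Import structures.
From mathcomp Require Import all_boot all_order all_algebra all_fingroup.
From mathcomp Require Import classical_sets reals ereal.

Set Implicit Arguments.
Unset Strict Implicit.
Unset Printing Implicit Defensive.

Import Order.TTheory GRing.Theory Num.Theory.

Local Open Scope classical_set_scope.
Local Open Scope ring_scope.

Inductive vertex (n : nat) : Type :=
| Player of 'I_n
| Source
| Dest.
Arguments Source {n}.
Arguments Dest {n}.

(* [bus_order G j k] is the player in position [k] of the order of bus [j]. *)
Record game (R : realType) (n m : nat) : Type := Game {
  dist : vertex n -> vertex n -> R;
  bus_order : 'I_m -> 'S_n;
  players_gt0 : (0 < n)%N;
  buses_gt1 : (1 < m)%N;
  dist_ge0 : forall x y, 0 <= dist x y;
  dist_sym : forall x y, dist x y = dist y x;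
  dist_xx : forall x, dist x x = 0
}.

Definition metric (R : realType) (n m : nat) (G : game R n m) : Prop :=
  forall x y w, dist G x w <= dist G x y + dist G y w.

Definition outcome (n m : nat) : Type := {ffun 'I_n -> 'I_m}.

Section Cost.
Context (R : realType) (n m : nat) (G : game R n m) (sigma : outcome n m).

Definition visited (j : 'I_m) : seq 'I_n :=
  [seq i <- [seq bus_order G j k | k <- enum 'I_n] | sigma i == j].

(* Numbered from 0; the stop of index [size (visited j)] is [Dest].         *)
Definition stop (j : 'I_m) (l : nat) : vertex n :=
  nth Dest [seq Player i | i <- visited j] l.

Definition cost (i : 'I_n) : R :=
  let j := sigma i in
  \sum_(index i (visited j) <= l < size (visited j))
     dist G (stop j l) (stop j l.+1).

(* Costs are nonnegative, so the base value 0 does not affect the maximum.  *)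
Definition egalitarian : R := \big[Num.max/0]_(i < n) cost i.

End Cost.

Section Sequential.
Context (n m : nat).

Definition history (sigma : outcome n m) (i : 'I_n) : i.-tuple 'I_m :=
  [tuple sigma (widen_ord (ltnW (ltn_ord i)) k) | k < i].

Definition profile : Type :=
  {dffun forall i : 'I_n, {ffun i.-tuple 'I_m -> 'I_m}}.

Definition choose_bus (sigma : outcome n m) (i : 'I_n) (j : 'I_m) :
    outcome n m :=
  [ffun k => if k == i then j else sigma k].

(* The outcome reached from the history formed by the first [i] entries of  *)
(* [sigma] when the remaining players move in turn according to [lambda];   *)
(* the other entries of [sigma] are overwritten before they are ever read.  *)
Definition play (lambda : profile) (i : nat) (sigma : outcome n m) :
    outcome n m :=
  foldl (fun tau k => choose_bus tau k (lambda k (history tau k))) sigma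
        [seq k : 'I_n <- enum 'I_n | (i <= k)%N].

Lemma play_lt (lambda : profile) (i : nat) (sigma : outcome n m) (k : 'I_n) :
  (k < i)%N -> play lambda i sigma k = sigma k.
Proof.
rewrite /play ltnNge => ik; set s := [seq _ <- _ | _].
have : k \notin s by rewrite mem_filter (negbTE ik).
elim: s sigma => //= a s IH sigma; rewrite inE negb_or => /andP[ka ks].
by rewrite IH // ffunE (negbTE ka).
Qed.

Lemma play_ge (lambda : profile) (i : nat) (sigma : outcome n m) (k : 'I_n) :
  (i <= k)%N ->
  play lambda i sigma k = lambda k (history (play lambda i sigma) k).
Proof.
rewrite /play => ik; set s := [seq _ <- _ | _].
have ks : k \in s by rewrite mem_filter ik mem_enum.
have : sorted (fun a b : 'I_n => (a < b)%N) s.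
  apply: sorted_filter => [a b c|]; first exact: ltn_trans.
  by have := iota_ltn_sorted 0 n; rewrite -val_enum_ord sorted_map.
have out (t : seq 'I_n) (tau : outcome n m) (l : 'I_n) : l \notin t ->
    foldl (fun tau k => choose_bus tau k (lambda k (history tau k))) tau t l
    = tau l.
  elim: t tau => //= a t IH tau; rewrite inE negb_or => /andP[la lt].
  by rewrite IH // ffunE (negbTE la).
elim: s sigma ks => //= a s IH sigma; rewrite inE.
move=> /orP[/eqP-> |ks] sas; last exact: IH ks (path_sorted sas).
have /allP as_lt : all (fun b : 'I_n => (a < b)%N) s.
  by apply: order_path_min sas => x y z; exact: ltn_trans.
have nas : a \notin s by apply/negP => /as_lt; rewrite ltnn.
rewrite out // ffunE eqxx; congr (lambda a _); apply: eq_from_tnth => l.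
set b := widen_ord (ltnW (ltn_ord a)) l.
rewrite !tnth_mktuple -/b out.
  by rewrite ffunE; case: eqP => // ba; have := ltn_ord l; rewrite -{2}ba ltnn.
by apply/negP => /as_lt; rewrite ltnNge ltnW //; exact: (ltn_ord l).
Qed.

End Sequential.

Section SubgamePerfect.
Context (R : realType) (n m : nat) (G : game R n m).

Definition outcome0 : outcome n m := [ffun=> Ordinal (ltnW (buses_gt1 G))].

Definition outcome_of (lambda : profile n m) : outcome n m :=
  play lambda 0 outcome0.

(* The history at which player [i] moves is the prefix [history sigma i].   *)
Definition is_spe (lambda : profile n m) : bool :=
  [forall i : 'I_n, forall sigma : outcome n m, forall j : 'I_m,
    cost G (play lambda i sigma) i <=
    cost G (play lambda i.+1 (choose_bus sigma i j)) i].

Definition optimum (f : game R n m -> outcome n m -> R) : outcome n m :=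
  [arg min_(sigma < outcome0) f G sigma]%O.

(* The ratios are nonnegative for a nonnegative [f].                        *)
Definition SPoA (f : game R n m -> outcome n m -> R) : R :=
  \big[Num.max/0]_(lambda : profile n m | is_spe lambda)
     (f G (outcome_of lambda) / f G (optimum f)).

End SubgamePerfect.

Definition SPoA_class (R : realType) (n m : nat)
    (f : game R n m -> outcome n m -> R) (C : set (game R n m)) : \bar R :=
  ereal_sup [set (SPoA G f)%:E | G in C `&` [set G | 0 < f G (optimum G f)]].

(* Main.v *)
Require Import Defs.
From mathcomp Require Import all_boot all_order all_algebra.
From mathcomp Require Import all_fingroup lra.
From mathcomp Require Import classical_sets reals ereal.

(** Let [D] be the largest distance of a player to the destination. In a metric
    game every outcome costs at least [D], and at most [(2n-1) D], since a bus
    makes at most [n] steps, each of length at most [2 D], and the last one of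
    length at most [D]; equilibrium plays no role here. The bound is attained
    on the star with centre the destination and unit edges, all buses visiting
    the players in the order in which these move: when every player copies her
    predecessor, a player cannot influence the number of players
    visited after her on her bus, so she is indifferent between all buses. *)

Set Implicit Arguments.
Unset Strict Implicit.
Unset Printing Implicit Defensive.

Import Order.TTheory GRing.Theory Num.Theory.

Local Open Scope classical_set_scope.
Local Open Scope ring_scope.

Section Visited.
Context (R : realType) (n m : nat) (G : game R n m) (sigma : outcome n m).

Lemma visited_uniq j : uniq (visited G sigma j).
Proof.
by rewrite filter_uniq // map_inj_uniq ?enum_uniq //; exact: perm_inj.
Qed.

Lemma mem_visited i : i \in visited G sigma (sigma i).
Proof.
rewrite mem_filter eqxx; apply/mapP.
by exists ((bus_order G (sigma i))^-1%g i); rewrite ?mem_enum ?permKV.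
Qed.

Lemma size_visited_le j : (size (visited G sigma j) <= n)%N.
Proof.
rewrite size_filter (leq_trans (count_size _ _)) //.
by rewrite size_map size_enum_ord.
Qed.

Lemma stop_player i0 j l : (l < size (visited G sigma j))%N ->
  stop G sigma j l = Player (nth i0 (visited G sigma j) l).
Proof. by move=> ls; rewrite /stop (nth_map i0). Qed.

Lemma stop_size j : stop G sigma j (size (visited G sigma j)) = Dest.
Proof. by rewrite /stop nth_default ?size_map. Qed.

Lemma egalitarian_ge i : cost G sigma i <= egalitarian G sigma.
Proof. exact: le_bigmax. Qed.

Lemma egalitarian_le (c : R) : 0 <= c ->
  (forall i, cost G sigma i <= c) -> egalitarian G sigma <= c.
Proof. by move=> c0 H; apply/bigmax_leP; split. Qed.

Hypothesis Gm : metric G.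

(** The rest of the bus route is a path from the player to [Dest], so iterating the triangle
    inequality along it gives the bound. *)
Lemma dist_Dest_le_cost i : dist G (Player i) Dest <= cost G sigma i.
Proof.
rewrite /cost; set j := sigma i; set s := visited G sigma j.
have is_ : (index i s < size s)%N by rewrite index_mem mem_visited.
have tele a b : (a <= b)%N -> dist G (stop G sigma j a) (stop G sigma j b) <=
    \sum_(a <= l < b) dist G (stop G sigma j l) (stop G sigma j l.+1).
  move=> ab; rewrite -(subnKC ab); elim: (b - a)%N => [|k IH].
    by rewrite addn0 big_geq // dist_xx.
  rewrite addnS big_nat_recr ?leq_addr //=.
  by apply: le_trans (Gm _ (stop G sigma j (a + k)) _) _; rewrite lerD2r.
have := tele _ _ (ltnW is_).
by rewrite stop_size (stop_player i) // nth_index ?mem_visited.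
Qed.

Lemma cost_le (D : R) i : (forall k, dist G (Player k) Dest <= D) ->
  cost G sigma i <= (2 * n%:R - 1) * D.
Proof.
move=> HD; have D0 : 0 <= D by apply: le_trans (dist_ge0 _ _ _) (HD i).
rewrite /cost; set j := sigma i; set s := visited G sigma j.
have is_ : (index i s < size s)%N by rewrite index_mem mem_visited.
(* Indices past the last player are covered too: there [stop] takes its default value [Dest]. *)
have stopD l : dist G (stop G sigma j l) Dest <= D.
  have [ls|ls] := ltnP l (size s); first by rewrite (stop_player i) ?HD.
  by rewrite /stop nth_default ?size_map // dist_xx.
have stepD l : dist G (stop G sigma j l) (stop G sigma j l.+1) <= 2 * D.
  apply: le_trans (Gm _ Dest _) _.
  by rewrite (dist_sym G Dest) mulr2n mulrDl mul1r lerD.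
have sn : (size s <= n)%N by exact: size_visited_le.
move: is_ sn (stop_size j); rewrite -/s.
case: (size s) => // k ik kn sk.
(* The step split off here ends at [Dest], so [stopD] applies to it instead of [stepD]; this gives
   the [- 1] in the bound. *)
rewrite big_nat_recr //= sk.
have -> : (2 * n%:R - 1) * D = (2 * D) * n.-1%:R + D.
  by rewrite -{1}(ltn_predK kn) -natr1; lra.
apply: lerD (stopD _).
apply: (@le_trans _ _ (\sum_(index i s <= l < k) 2 * D)).
  by apply: ler_sum => l _.
rewrite sumr_const_nat -(mulr_natr (2 * D)) ler_wpM2l ?mulr_ge0 // ler_nat.
by rewrite (leq_trans (leq_subr _ _)) // -ltnS (ltn_predK kn).
Qed.

End Visited.

Lemma optimum_le (R : realType) (n m : nat) (G : game R n m)
    (f : game R n m -> outcome n m -> R) sigma :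
  f G (optimum G f) <= f G sigma.
Proof. by rewrite /optimum; case: arg_minP => // tau _ ->. Qed.

(** The optimal social cost itself can serve as [D] in [cost_le]: it is at least the cost of each
    player in the optimum, hence at least her distance to [Dest]. *)
Lemma SPoA_egalitarian_le (R : realType) (n m : nat) (G : game R n m) :
  metric G -> 0 < egalitarian G (optimum G (@egalitarian R n m)) ->
  SPoA G (@egalitarian R n m) <= 2 * n%:R - 1.
Proof.
move=> Gm; set D := egalitarian G _ => D0.
have n1 : 0 <= 2 * n%:R - 1 :> R.
  by have := players_gt0 G; rewrite -(ler_nat R) => n1; lra.
apply/bigmax_leP; split=> // lambda _; rewrite ler_pdivrMr //.
apply: egalitarian_le => [|i]; first exact: mulr_ge0 n1 (ltW D0).
apply: cost_le => // k.
apply: le_trans (egalitarian_ge G (optimum G (@egalitarian R n m)) k).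
exact: dist_Dest_le_cost.
Qed.

Section Star.
Context (R : realType) (n m : nat) (n_gt0 : (0 < n)%N) (m_gt1 : (1 < m)%N).

(** [Source] and [Dest] both sit at the centre of the star, at distance 0 from each other. *)
Definition star_dist (x y : vertex n) : R :=
  match x, y with
  | Player i, Player k => if i == k then 0 else 2
  | Player _, _ | _, Player _ => 1
  | _, _ => 0
  end.

Lemma star_dist_ge0 x y : 0 <= star_dist x y.
Proof. by case: x y => [i||] [k||] //=; case: ifP. Qed.

Lemma star_dist_sym x y : star_dist x y = star_dist y x.
Proof. by case: x y => [i||] [k||] //=; rewrite eq_sym. Qed.

Lemma star_dist_xx x : star_dist x x = 0.
Proof. by case: x => [i||] //=; rewrite eqxx. Qed.

Definition star : game R n m :=
  Game (fun=> 1%g) n_gt0 m_gt1 star_dist_ge0 star_dist_sym star_dist_xx.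

Lemma star_metric : metric star.
Proof.
move=> [i||] [k||] [l||] //=; try (by lra); try by case: ifP => _; lra.
(* Three players: if the first two coincide, both sides agree; otherwise the right side is already
   at least 2. *)
by have [->|_] := eqVneq i k; do !case: ifP => _; lra.
Qed.

Lemma visited_star (sigma : outcome n m) j :
  visited star sigma j = [seq i <- enum 'I_n | sigma i == j].
Proof.
by rewrite /visited /= (eq_map (g := id)) ?map_id // => k; rewrite perm1.
Qed.

(** Of the [size s - index i s] remaining steps, the last has length 1 and each other one joins two
    distinct players, at distance 2. *)
Lemma cost_star (sigma : outcome n m) i :
  let s := visited star sigma (sigma i) in
  cost star sigma i = 2 * (size s - index i s)%:R - 1.
Proof.
move=> s; rewrite /cost -/s.
have : (index i s < size s)%N by rewrite index_mem mem_visited.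
have := stop_size star sigma (sigma i); rewrite -/s.
case Es : (size s) => [//|k] sk ik.
rewrite big_nat_recr //= sk (stop_player i) -/s ?Es //=.
rewrite (eq_big_nat _ _ (F2 := fun=> 2)); last first.
  move=> l /andP[_ lk]; rewrite !(stop_player i) -/s ?Es ?ltnS //; last exact: ltnW.
  by rewrite /= nth_uniq ?visited_uniq ?Es ?ltnS //= ?ltn_eqF // ltnW.
by rewrite sumr_const_nat subSn // -natr1 -(mulr_natr 2); lra.
Qed.

(** Earlier players sharing the bus are visited before [i], so they shift [size] and [index] equally
    and cancel. The cost thus depends neither on the history nor on the bus, which is the source of
    the indifference. *)
Lemma cost_star_tail (sigma : outcome n m) (i : 'I_n) :
  (forall k : 'I_n, (i <= k)%N -> sigma k = sigma i) ->
  cost star sigma i = 2 * (n - i)%:R - 1.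
Proof.
move=> Hi; rewrite cost_star visited_star -{1 2}(cat_take_drop i (enum 'I_n)).
rewrite filter_cat.
have -> : [seq k <- drop i (enum 'I_n) | sigma k == sigma i] =
          drop i (enum 'I_n).
  apply/all_filterP/allP => k /(nthP i)[l].
  rewrite size_drop size_enum_ord => li <-; rewrite nth_drop Hi //.
  by rewrite nth_enum_ord ?leq_addr // -ltn_subRL.
have in_ : (i < size (enum 'I_n))%N by rewrite size_enum_ord.
have iE : nth i (enum 'I_n) i = i by apply: val_inj; rewrite /= nth_enum_ord.
rewrite index_cat mem_filter (_ : i \in take _ _ = false); last first.
  apply/negbTE/(nthP i) => -[l]; rewrite size_take in_ => li.
  rewrite nth_take // => /(congr1 val); rewrite /= nth_enum_ord.
    by move=> li'; rewrite li' ltnn in li.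
  exact: ltn_trans li _.
rewrite andbF (drop_nth i in_) iE /= eqxx addn0 size_cat /= addKn.
by rewrite size_drop size_enum_ord subnSK.
Qed.

(** The default of [last] is reached only by the first player, whose history is empty; she takes bus
    0. *)
Definition copycat : profile n m :=
  [ffun i : 'I_n => [ffun h : i.-tuple 'I_m => last (Ordinal (ltnW m_gt1)) h]].

Lemma copycat_pred (sigma : outcome n m) (i k : 'I_n) : i.+1 = k ->
  copycat k (history sigma k) = sigma i.
Proof.
move=> ik; have lk : (i < k)%N by rewrite -ik.
rewrite !ffunE (last_nth (sigma i)) size_tuple -[X in nth _ _ X]ik /=.
rewrite -[LHS](tnth_nth _ (history sigma k) (Ordinal lk)) tnth_mktuple.
by congr (sigma _); exact: val_inj.
Qed.

(** The bound [a <= i.+1] lets player [i] herself deviate, so that equilibrium play and play after a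
    deviation are both covered. *)
Lemma play_copycat a (sigma : outcome n m) (i k : 'I_n) :
  (a <= i.+1)%N -> (i <= k)%N ->
  play copycat a sigma k = play copycat a sigma i.
Proof.
move=> ai ik; set tau := play _ _ _.
have H d : forall k : 'I_n, k = (i + d)%N :> nat -> tau k = tau i.
  elim: d => [|d IH] l; first by rewrite addn0 => /val_inj->.
  rewrite addnS => lE.
  have dn : (i + d < n)%N by rewrite (leq_trans _ (ltn_ord l)) // lE.
  rewrite -(IH (Ordinal dn)) //; rewrite {1}/tau play_ge -/tau; last first.
    by rewrite (leq_trans ai) // lE ltnS leq_addr.
  exact: copycat_pred.
by apply: (H (k - i)%N); rewrite subnKC.
Qed.

(** The followers copy a deviation as well, so both sides of the inequality equal
    [2 * (n - i)%:R - 1]. *)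
Lemma copycat_spe : is_spe star copycat.
Proof.
apply/'forall_forallP => i sigma; apply/forallP => j.
rewrite !cost_star_tail // => k ik; apply: play_copycat => //.
Qed.

Lemma cost_copycat (i : 'I_n) :
  cost star (outcome_of star copycat) i = 2 * (n - i)%:R - 1.
Proof. by apply: cost_star_tail => k ik; apply: play_copycat. Qed.

Lemma star_optimum_ge1 :
  1 <= egalitarian star (optimum star (@egalitarian R n m)).
Proof.
have := dist_Dest_le_cost (optimum star (@egalitarian R n m)) star_metric
  (Ordinal n_gt0).
by move/le_trans; apply; exact: egalitarian_ge.
Qed.

End Star.

Lemma star_optimum_le1 (R : realType) (n : nat)
    (n_gt0 : (0 < n)%N) (n_gt1 : (1 < n)%N) :
  egalitarian (star R n_gt0 n_gt1)
    (optimum (star R n_gt0 n_gt1) (@egalitarian R n n)) <= 1.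
Proof.
(* With as many buses as players, each player can ride alone and pays only her unit edge to
   [Dest]. *)
apply: le_trans (optimum_le _ _ [ffun i => i]) _.
apply: egalitarian_le => // i; rewrite cost_star visited_star.
set s := [seq _ <- _ | _].
have s1 : (size s <= 1)%N.
  rewrite size_filter (eq_count (a2 := pred1 i)) => [|k /=]; last by rewrite !ffunE.
  by rewrite count_uniq_mem ?enum_uniq // leq_b1.
have : (size s - index i s <= 1)%N := leq_trans (leq_subr _ _) s1.
by rewrite -(ler_nat R); lra.
Qed.

Theorem theorem3p5 (R : realType) (n : nat) (hn : (2 <= n)%N) :
  SPoA_class (@egalitarian R n n) [set G : game R n n | metric G] =
  (2 * n%:R - 1)%:E.
Proof.
apply/eqP; rewrite eq_le; apply/andP; split.
  apply: ge_ereal_sup => _ [G [Gm G0] <-]; rewrite lee_fin.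
  exact: SPoA_egalitarian_le.
have n0 : (0 < n)%N := ltnW hn.
pose G := star R n0 hn.
have opt_ge1 : 1 <= egalitarian G (optimum G (@egalitarian R n n)).
  exact: star_optimum_ge1.
have opt_gt0 := lt_le_trans ltr01 opt_ge1.
apply: le_trans (ereal_sup_ubound _); last first.
  by exists G => //; split=> //; exact: star_metric.
rewrite lee_fin.
apply: le_trans (le_bigmax_cond _ _ (copycat_spe R n0 hn)).
have opt1 : egalitarian G (optimum G (@egalitarian R n n)) = 1.
  by apply/eqP; rewrite eq_le opt_ge1 star_optimum_le1.
rewrite -/G opt1 divr1.
(* The first mover has all [n] players on her bus from her stop onwards, so she pays the full
   [2 * n%:R - 1]. *)
apply: le_trans (egalitarian_ge _ _ (Ordinal n0)).
by rewrite cost_copycat subn0.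
Qed.
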